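(* Let $\mathcal{H}$ be a separable right quaternionic Hilbert space with orthonormal bases indexed by $\mathbb{N}$, and let $T\in\mathcal{B}(\mathcal{H})$ be a normal operator. Let $D\in\mathcal{B}(\mathcal{H})$ be a diagonal operator with $T\sim_a D$ and $De_k=e_kd_k$ for some orthonormal basis $\{e_k:k\in\mathbb{N}\}$ of $\mathcal{H}$, where $d_k=h_k+s_ki\in\mathbb{C}$ with $h_k\in\mathbb{R}$ and $s_k\geq 0$, and suppose that the $d_k$ are the right eigenvalues of $T$, i.e. $\sigma_r(T)=\bigcup_k[d_k]$. Put $\underline{v}=\inf\,(B(T)\cap\mathbb{R})$ and $\overline{v}=\sup\,(B(T)\cap\mathbb{R})$, and for $k\neq j$ put $\underline{c}_{kj}=\min\,([d_k,d_j^*]\cap\mathbb{R})$ and $\overline{c}_{kj}=\max\,([d_k,d_j^*]\cap\mathbb{R})$. Then $$\underline{v}=\inf\{\underline{c}_{kj}:k,j\in\mathbb{N},\ k\neq j\}\qquad\text{and}\qquad \overline{v}=\sup\{\overline{c}_{kj}:k,j\in\mathbb{N},\ k\neq j\}.$$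
   Context: $\mathbb{H}$ denotes the real quaternions with basis $\{1,i,j,k\}$, and $\mathbb{C}=\mathrm{span}_{\mathbb{R}}\{1,i\}\subset\mathbb{H}$. For $q\in\mathbb{H}$, $[q]=\{s^*qs:s\in\mathbb{H},|s|=1\}$ is its similarity class; for two complex numbers $a,b$, $[a,b]$ is the closed line segment joining them in $\mathbb{C}$, and $d_j^*$ is the complex conjugate of $d_j$. $\mathcal{H}$ is a right quaternionic Hilbert space with inner product $\langle\cdot,\cdot\rangle$ that is right $\mathbb{H}$-linear in the first variable, satisfies $\langle x,y\rangle=\langle y,x\rangle^*$ and is positive definite; $\mathcal{H}$ is separable, with countable orthonormal bases indexed by $\mathbb{N}$. $\mathcal{B}(\mathcal{H})$ is the set of bounded right $\mathbb{H}$-linear operators on $\mathcal{H}$ with the operator norm; $T$ is normal if $T^*T=TT^*$. The quaternionic numerical range is $W(T)=\{\langle Tx,x\rangle:x\in\mathcal{H},\|x\|=1\}\subset\mathbb{H}$ and the bild is $B(T)=W(T)\cap\mathbb{C}$. The set of right eigenvalues is $\sigma_r(T)=\{q\in\mathbb{H}:Tx=xq\text{ for some }x\in\mathcal{H}\setminus\{0\}\}$. $T\sim_a D$ (approximate unitary equivalence) means there is a sequence of unitary operators $(U_n)_n$ on $\mathcal{H}$ with $\lim_{n\to\infty}\|U_nDU_n^*-T\|=0$. The sequence $(d_k)$ may contain repetitions. *)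

(* Defs.v *)
From HB Require Import structures.
From mathcomp Require Import all_boot all_order all_algebra.
From mathcomp Require Import ring lra.
From mathcomp Require Import all_classical all_reals all_analysis.

Set Implicit Arguments.
Unset Strict Implicit.
Unset Printing Implicit Defensive.

Import Order.TTheory GRing.Theory Num.Theory.
Import numFieldNormedType.Exports.

Local Open Scope classical_set_scope.
Local Open Scope ring_scope.

(** [Quat a b c d] is [a + b i + c j + d k]. *)

Record quat (R : Type) := Quat { qre : R; qimi : R; qimj : R; qimk : R }.

Definition quat_to_prod (R : Type) (q : quat R) : R * R * R * R :=
  (qre q, qimi q, qimj q, qimk q).
Definition prod_to_quat (R : Type) (p : R * R * R * R) : quat R :=
  let: (a, b, c, d) := p in Quat a b c d.
Lemma quat_to_prodK (R : Type) : cancel (@quat_to_prod R) (@prod_to_quat R).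
Proof. by case. Qed.

HB.instance Definition _ (R : eqType) :=
  Equality.copy (quat R) (can_type (@quat_to_prodK R)).
HB.instance Definition _ (R : choiceType) :=
  Choice.copy (quat R) (can_type (@quat_to_prodK R)).

Section QuatRing.
Variable R : comNzRingType.
Implicit Types p q r : quat R.

Definition addq p q : quat R :=
  Quat (qre p + qre q) (qimi p + qimi q) (qimj p + qimj q) (qimk p + qimk q).
Definition oppq p : quat R := Quat (- qre p) (- qimi p) (- qimj p) (- qimk p).
Definition mulq p q : quat R :=
  Quat (qre p * qre q - qimi p * qimi q - qimj p * qimj q - qimk p * qimk q)
       (qre p * qimi q + qimi p * qre q + qimj p * qimk q - qimk p * qimj q)
       (qre p * qimj q - qimi p * qimk q + qimj p * qre q + qimk p * qimi q)
       (qre p * qimk q + qimi p * qimj q - qimj p * qimi q + qimk p * qre q).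

Fact addqA : associative addq.
Proof. by move=> p q r; congr Quat => /=; rewrite addrA. Qed.
Fact addqC : commutative addq.
Proof. by move=> p q; congr Quat; rewrite addrC. Qed.
Fact add0q : left_id (Quat 0 0 0 0) addq.
Proof. by move=> [a b c d]; congr Quat => /=; rewrite add0r. Qed.
Fact addNq : left_inverse (Quat 0 0 0 0) oppq addq.
Proof. by move=> p; congr Quat => /=; rewrite addNr. Qed.
HB.instance Definition _ :=
  GRing.isZmodule.Build (quat R) addqA addqC add0q addNq.

Fact mulqA : associative mulq.
Proof. by move=> p q r; congr Quat => /=; ring. Qed.
Fact mul1q : left_id (Quat 1 0 0 0) mulq.
Proof. by move=> [a b c d]; congr Quat => /=; ring. Qed.
Fact mulq1 : right_id (Quat 1 0 0 0) mulq.
Proof. by move=> [a b c d]; congr Quat => /=; ring. Qed.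
Fact mulqDl : left_distributive mulq +%R.
Proof. by move=> p q r; congr Quat => /=; ring. Qed.
Fact mulqDr : right_distributive mulq +%R.
Proof. by move=> p q r; congr Quat => /=; ring. Qed.
Fact oneq_neq0 : Quat 1 0 0 0 != 0 :> quat R.
Proof. by apply/eqP => -[/eqP]; rewrite oner_eq0. Qed.
HB.instance Definition _ := GRing.Zmodule_isNzRing.Build (quat R)
  mulqA mul1q mulq1 mulqDl mulqDr oneq_neq0.

Definition conjq q : quat R := Quat (qre q) (- qimi q) (- qimj q) (- qimk q).
Definition realq (a : R) : quat R := Quat a 0 0 0.
Definition complexq (a b : R) : quat R := Quat a b 0 0.

(** [C = span_R {1, i}] *)
Definition complex_plane : set (quat R) :=
  [set q | qimj q = 0 /\ qimk q = 0].

(** [A ∩ R], as a set of elements of [R] *)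
Definition real_part_of (A : set (quat R)) : set R := @realq @^-1` A.

End QuatRing.

Section QuatSets.
Variable R : realType.

Definition normq (q : quat R) : R :=
  Num.sqrt (qre q ^+ 2 + qimi q ^+ 2 + qimj q ^+ 2 + qimk q ^+ 2).

Definition sim_class (q : quat R) : set (quat R) :=
  [set conjq s * q * s | s in [set s | normq s = 1]].

Definition segment (a b : quat R) : set (quat R) :=
  [set realq (1 - t) * a + realq t * b | t in `[0, 1] ].

(** Least and greatest elements of a set of reals; a set has at most one of
    each, and the value is 0 when there is none. *)
Definition min_elt (A : set R) : R := xget 0 [set m | A m /\ lbound A m].
Definition max_elt (A : set R) : R := xget 0 [set m | A m /\ ubound A m].

End QuatSets.

(** A right H-module is a left module over the converse ring [H^c]: with
    [x q := q *: x] one has [(x p) q = x (p q)]. *)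
Definition rscale (R : realType) (V : lmodType (quat R)^c) (x : V)
  (q : quat R) : V := (q : (quat R)^c) *: x.

HB.mixin Record isRightQuatPreHilbert (R : realType) V
    of GRing.Lmodule (quat R)^c V := {
  inner : V -> V -> quat R;
  innerDl : forall x y z : V, inner (x + y) z = inner x z + inner y z;
  innerZl : forall (x y : V) (q : quat R),
    inner (rscale x q) y = inner x y * q;
  inner_conj : forall x y : V, inner x y = conjq (inner y x);
  inner_ge0 : forall x : V, 0 <= qre (inner x x);
  inner_eq0 : forall x : V, inner x x = 0 -> x = 0
}.

#[short(type="rightQuatPreHilbertType")]
HB.structure Definition RightQuatPreHilbert (R : realType) :=
  { V of GRing.Lmodule (quat R)^c V & isRightQuatPreHilbert R V }.

(** [inner x x] is real by [inner_conj]. *)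
Definition hnorm (R : realType) (V : rightQuatPreHilbertType R) (x : V) : R :=
  Num.sqrt (qre (inner x x)).

(** The library's normed and topological modules require a commutative scalar
    ring, so convergence in [V] is stated through [hnorm]. *)
Definition hcvg (R : realType) (V : rightQuatPreHilbertType R)
  (u : nat -> V) (l : V) : Prop :=
  (fun n => hnorm (u n - l)) @ \oo --> (0 : R).

Definition hcauchy (R : realType) (V : rightQuatPreHilbertType R)
  (u : nat -> V) : Prop :=
  forall eps : R, 0 < eps ->
    exists N, forall m n, (N <= m)%N -> (N <= n)%N -> hnorm (u m - u n) < eps.

HB.mixin Record isRightQuatComplete (R : realType) V
    of RightQuatPreHilbert R V := {
  hcomplete : forall u : nat -> V, hcauchy u -> exists l, hcvg u l
}.

#[short(type="rightQuatHilbertType")]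
HB.structure Definition RightQuatHilbert (R : realType) :=
  { V of RightQuatPreHilbert R V & isRightQuatComplete R V }.

Section Operators.
Variables (R : realType) (V : rightQuatHilbertType R).

Definition separable_space : Prop :=
  exists u : nat -> V,
    forall (x : V) (eps : R), 0 < eps -> exists n, hnorm (x - u n) < eps.

Definition orthonormal_basis (e : nat -> V) : Prop :=
  (forall m n, inner (e m) (e n) = (m == n)%:R) /\
  (forall x, hcvg (fun n => \sum_(k < n) rscale (e k) (inner x (e k))) x).

Definition bounded_op (T : V -> V) : Prop :=
  exists M : R, forall x, hnorm (T x) <= M * hnorm x.

Definition opnorm (T : V -> V) : R :=
  sup [set hnorm (T x) | x in [set x : V | hnorm x <= 1]].

(** [S = T^*].  A map has at most one adjoint ([adjoint_unique] below), and by
    the Riesz representation theorem every bounded operator has one. *)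
Definition is_adjoint (T S : V -> V) : Prop :=
  forall x y, inner (T x) y = inner x (S y).

Definition normal_op (T : V -> V) : Prop :=
  exists2 S : V -> V, is_adjoint T S & S \o T =1 T \o S.

Definition unitary_with_adjoint (U S : V -> V) : Prop :=
  [/\ bounded_op U, is_adjoint U S, S \o U =1 id & U \o S =1 id].

Definition approx_unitarily_equiv (T D : V -> V) : Prop :=
  exists (U : nat -> {linear V -> V}) (S : nat -> V -> V),
    (forall n, unitary_with_adjoint (U n) (S n)) /\
    (fun n => opnorm (fun x => U n (D (S n x)) - T x)) @ \oo --> (0 : R).

Definition numerical_range (T : V -> V) : set (quat R) :=
  [set inner (T x) x | x in [set x : V | hnorm x = 1]].

Definition bild (T : V -> V) : set (quat R) :=
  numerical_range T `&` @complex_plane R.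

Definition right_eigenvalues (T : V -> V) : set (quat R) :=
  [set q | exists2 x : V, x != 0 & T x = rscale x q].

Lemma adjoint_unique (T S S' : V -> V) :
  is_adjoint T S -> is_adjoint T S' -> S =1 S'.
Proof.
move=> TS TS' y; apply/eqP; rewrite -subr_eq0; apply/eqP/inner_eq0.
have innerNl (u v : V) : inner (- u) v = - inner u v.
  have inner0l : inner (0 : V) v = 0.
    by apply: (addrI (inner (0 : V) v)); rewrite -innerDl !addr0.
  by apply/eqP; rewrite -addr_eq0 -innerDl addNr inner0l.
set w := S y - S' y.
have Sw : inner (S y) w = inner (S' y) w.
  by rewrite inner_conj -TS TS' -inner_conj.
by rewrite {1}/w innerDl innerNl Sw subrr.
Qed.

End Operators.

(* Main.v *)
Require Import Defs.
From mathcomp Require Import all_boot all_order all_algebra.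
From mathcomp Require Import ring lra.
From mathcomp Require Import all_classical all_reals all_analysis.

Set Implicit Arguments.
Unset Strict Implicit.
Unset Printing Implicit Defensive.

Import Order.TTheory GRing.Theory Num.Theory.
Import numFieldNormedType.Exports.

Local Open Scope classical_set_scope.
Local Open Scope ring_scope.

(** The quadratic form of [D] is [sum_k x_k^* d_k x_k], with real part
    [sum_k h_k |x_k|^2] and imaginary part [sum_k s_k x_k^* i x_k].

    If [m <= c_kj] for all [k <> j], then [s_j (h_k - m) + s_k (h_j - m) >= 0],
    so at most one [h_k - m] is negative, and its effect is compensated by the
    others as soon as the imaginary parts cancel: for some [lam >= 0],
    [Re <Dx,x> >= m |x|^2 - lam |Im <Dx,x>|].  This robust form survives the
    approximate unitary equivalence and bounds the real part of the bild of [T].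
    The upper bounds are the case of [- T].

    Conversely, if [d_k <> d_j] then [T] has orthogonal unit eigenvectors
    [v_k], [v_j], and [v_k sqrt(1-t) + v_j j sqrt(t)] attains the real point of
    [[d_k, d_j^*]].  If [d_k = d_j = h + s i], only one eigenvector [v] of [T]
    may exist; but some unit combination [z] of [U_n e_k] and [U_n e_j] is
    orthogonal to [v], and [Re <Tz,z>] is close to [h].  As the orthogonal
    complement of [v] reduces [T], mixing [v] with a rotated copy of [z] cancels
    the imaginary parts exactly and gives a real point of the bild near [h]. *)

(** * Quaternion arithmetic, rotation of imaginary parts, similarity of complex numbers *)

Section Quaternions.
Variable R : realType.
Implicit Types p q u : quat R.

Lemma quat_eq p q : qre p = qre q -> qimi p = qimi q -> qimj p = qimj q ->
  qimk p = qimk q -> p = q.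
Proof. by case: p q => ? ? ? ? [] ? ? ? ? /= -> -> -> ->. Qed.

Lemma qreD p q : qre (p + q) = qre p + qre q. Proof. by []. Qed.
Lemma qimiD p q : qimi (p + q) = qimi p + qimi q. Proof. by []. Qed.
Lemma qimjD p q : qimj (p + q) = qimj p + qimj q. Proof. by []. Qed.
Lemma qimkD p q : qimk (p + q) = qimk p + qimk q. Proof. by []. Qed.
Lemma qreN p : qre (- p) = - qre p. Proof. by []. Qed.
Lemma qimiN p : qimi (- p) = - qimi p. Proof. by []. Qed.
Lemma qimjN p : qimj (- p) = - qimj p. Proof. by []. Qed.
Lemma qimkN p : qimk (- p) = - qimk p. Proof. by []. Qed.
Lemma qreM p q : qre (p * q) =
  qre p * qre q - qimi p * qimi q - qimj p * qimj q - qimk p * qimk q.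
Proof. by []. Qed.
Lemma qimiM p q : qimi (p * q) =
  qre p * qimi q + qimi p * qre q + qimj p * qimk q - qimk p * qimj q.
Proof. by []. Qed.
Lemma qimjM p q : qimj (p * q) =
  qre p * qimj q - qimi p * qimk q + qimj p * qre q + qimk p * qimi q.
Proof. by []. Qed.
Lemma qimkM p q : qimk (p * q) =
  qre p * qimk q + qimi p * qimj q - qimj p * qimi q + qimk p * qre q.
Proof. by []. Qed.
Lemma qre0 : qre (0 : quat R) = 0. Proof. by []. Qed.
Lemma qimi0 : qimi (0 : quat R) = 0. Proof. by []. Qed.
Lemma qimj0 : qimj (0 : quat R) = 0. Proof. by []. Qed.
Lemma qimk0 : qimk (0 : quat R) = 0. Proof. by []. Qed.
Lemma qre1 : qre (1 : quat R) = 1. Proof. by []. Qed.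
Lemma qimi1 : qimi (1 : quat R) = 0. Proof. by []. Qed.
Lemma qimj1 : qimj (1 : quat R) = 0. Proof. by []. Qed.
Lemma qimk1 : qimk (1 : quat R) = 0. Proof. by []. Qed.

Definition quatE := (qreD, qimiD, qimjD, qimkD, qreN, qimiN, qimjN, qimkN,
  qreM, qimiM, qimjM, qimkM,
  (qre0, qimi0, qimj0, qimk0, qre1, qimi1, qimj1, qimk1)).

Lemma conjqM p q : conjq (p * q) = conjq q * conjq p.
Proof. by apply: quat_eq; rewrite /= ?quatE /=; ring. Qed.
Lemma conjqD p q : conjq (p + q) = conjq p + conjq q.
Proof. by apply: quat_eq; rewrite /= ?quatE /=; ring. Qed.
Lemma conjqN p : conjq (- p) = - conjq p.
Proof. by apply: quat_eq; rewrite /= ?quatE /=; ring. Qed.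
Lemma conjqK p : conjq (conjq p) = p.
Proof. by apply: quat_eq; rewrite /= ?opprK. Qed.

Definition sqnormq q : R :=
  qre q ^+ 2 + qimi q ^+ 2 + qimj q ^+ 2 + qimk q ^+ 2.

Lemma sqnormq_ge0 q : 0 <= sqnormq q.
Proof. by rewrite !addr_ge0 ?sqr_ge0. Qed.

Lemma sqnormq_eq0 q : sqnormq q = 0 -> q = 0.
Proof.
case: q => a b c d; rewrite /sqnormq /= => q0.
have /= := (sqr_ge0 a, sqr_ge0 b, sqr_ge0 c, sqr_ge0 d) => -[[[]]] ha hb hc hd.
have h0 x : x ^+ 2 = 0 -> x = 0 :> R by move/eqP; rewrite sqrf_eq0 => /eqP.
by apply: quat_eq => /=; apply: h0; lra.
Qed.

Lemma conjq_mul q : conjq q * q = realq (sqnormq q).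
Proof. by apply: quat_eq; rewrite /sqnormq /= ?quatE /=; ring. Qed.

Lemma realq_comm (a : R) q : realq a * q = q * realq a.
Proof. by apply: quat_eq; rewrite ?quatE /=; ring. Qed.

Lemma realqM (a b : R) : realq a * realq b = realq (a * b).
Proof. by apply: quat_eq; rewrite ?quatE /=; ring. Qed.

(* Conjugation by [w - p i], with [w] the imaginary part and [p] its length,
   is the half-turn exchanging [w / p] and [- i]. *)
Lemma rotate_to_lower_half q :
  exists u, exists2 p, 0 <= p & sqnormq u = 1 /\
    conjq u * q * u = complexq (qre q) (- p).
Proof.
case: q => a b c d /=.
set p := Num.sqrt (b ^+ 2 + c ^+ 2 + d ^+ 2).
have p2 : p ^+ 2 = b ^+ 2 + c ^+ 2 + d ^+ 2.
  by rewrite sqr_sqrtr // !addr_ge0 ?sqr_ge0.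
have p0 : 0 <= p by exact: sqrtr_ge0.
pose u := Quat 0 (b - p) c d.
have [u0|u0] := eqVneq (sqnormq u) 0.
  have [/eqP] := sqnormq_eq0 u0; rewrite subr_eq0 => /eqP bp c0 d0.
  (* The axis degenerates exactly when the quaternion is already [a + p i]; conjugation by j then
     sends i to - i. *)
  clearbody p; exists (Quat 0 0 1 0), p => //; split.
    by rewrite /sqnormq /=; ring.
  by apply: quat_eq; rewrite /= ?quatE /= ?c0 ?d0 ?bp //; ring.
have N0 : 0 < sqnormq u by rewrite lt_def u0 sqnormq_ge0.
pose r := (Num.sqrt (sqnormq u))^-1.
have r2 : r ^+ 2 * sqnormq u = 1.
  by rewrite exprVn sqr_sqrtr ?sqnormq_ge0 // mulVf.
exists (u * realq r), p => //.
have uE : conjq (u * realq r) * (Quat a b c d) * (u * realq r) =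
  realq (r ^+ 2) * (conjq u * Quat a b c d * u).
  by rewrite conjqM; apply: quat_eq; rewrite /= ?quatE /=; ring.
(* The imaginary components agree only modulo [p2]: the two sides differ by multiples of
   [b ^+ 2 + c ^+ 2 + d ^+ 2 - p ^+ 2]. *)
have uE2 : conjq u * Quat a b c d * u = realq (sqnormq u) * complexq a (- p).
  rewrite /sqnormq/u; apply: quat_eq; rewrite /= ?quatE /=; try ring.
  - apply/eqP; rewrite -subr_eq0; apply/eqP.
    transitivity ((b - p) * (b ^+ 2 + c ^+ 2 + d ^+ 2 - p ^+ 2)); first by ring.
    by rewrite p2; ring.
  - apply/eqP; rewrite -subr_eq0; apply/eqP.
    transitivity (c * (b ^+ 2 + c ^+ 2 + d ^+ 2 - p ^+ 2)); first by ring.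
    by rewrite p2; ring.
  - apply/eqP; rewrite -subr_eq0; apply/eqP.
    transitivity (d * (b ^+ 2 + c ^+ 2 + d ^+ 2 - p ^+ 2)); first by ring.
    by rewrite p2; ring.
split.
  by rewrite -[RHS]r2 /sqnormq ?quatE /=; ring.
by rewrite uE uE2 mulrA realqM r2; apply: quat_eq; rewrite ?quatE /=; ring.
Qed.

(** Write [q] as alpha + beta j with alpha, beta complex. The relation splits into (d1 - d2) alpha =
    0 and (conj d1 - d2) beta = 0; in the second case nonnegative imaginary parts force d1 = d2
    real. *)
Lemma intertwined_eq q (h1 s1 h2 s2 : R) : 0 <= s1 -> 0 <= s2 -> q != 0 ->
  q * complexq h1 s1 = complexq h2 s2 * q -> h1 = h2 /\ s1 = s2.
Proof.
case: q => a b c d s10 s20 q0 E.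
have := congr1 (@qre R) E; have := congr1 (@qimi R) E.
have := congr1 (@qimj R) E; have := congr1 (@qimk R) E.
rewrite ?quatE /= => E4 E3 E2 E1.
have ab (x y : R) : x ^+ 2 + y ^+ 2 = 0 -> x = 0 /\ y = 0.
  move/eqP; rewrite paddr_eq0 ?sqr_ge0 // !sqrf_eq0.
  by move=> /andP[/eqP -> /eqP ->].
have F1 : ((h1 - h2) ^+ 2 + (s1 - s2) ^+ 2) * (a ^+ 2 + b ^+ 2) = 0.
  have e1 : (h1 - h2) * a - (s1 - s2) * b = 0 by lra.
  have e2 : (h1 - h2) * b + (s1 - s2) * a = 0 by lra.
  transitivity (((h1 - h2) * a - (s1 - s2) * b) ^+ 2 +
                ((h1 - h2) * b + (s1 - s2) * a) ^+ 2); first by ring.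
  by rewrite e1 e2; ring.
have F2 : ((h1 - h2) ^+ 2 + (s1 + s2) ^+ 2) * (c ^+ 2 + d ^+ 2) = 0.
  have e1 : (h1 - h2) * c + (s1 + s2) * d = 0 by lra.
  have e2 : (h1 - h2) * d - (s1 + s2) * c = 0 by lra.
  transitivity (((h1 - h2) * c + (s1 + s2) * d) ^+ 2 +
                ((h1 - h2) * d - (s1 + s2) * c) ^+ 2); first by ring.
  by rewrite e1 e2; ring.
move/eqP: F1; rewrite mulf_eq0 => /orP[/eqP/ab[]|/eqP/ab[a0 b0]]; first by lra.
move/eqP: F2; rewrite mulf_eq0 => /orP[/eqP/ab[]|/eqP/ab[c0 d0]]; first by lra.
by move: q0; rewrite a0 b0 c0 d0 eqxx.
Qed.

End Quaternions.

(** * Inner product identities, Cauchy-Schwarz and the triangle inequality *)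

Section InnerProduct.
Variables (R : realType) (V : rightQuatPreHilbertType R).
Implicit Types (x y z : V) (p q : quat R).

Lemma rscaleM x p q : rscale (rscale x p) q = rscale x (p * q).
Proof. exact: scalerA. Qed.

Lemma inner0l y : inner 0 y = 0.
Proof. by apply: (addrI (inner 0 y)); rewrite -innerDl !addr0. Qed.

Lemma inner_suml (I : Type) (r : seq I) (F : I -> V) y :
  inner (\sum_(i <- r) F i) y = \sum_(i <- r) inner (F i) y.
Proof.
by elim/big_rec2: _ => [|i a b _ <-]; [exact: inner0l|exact: innerDl].
Qed.

Lemma innerNl x y : inner (- x) y = - inner x y.
Proof. by apply/eqP; rewrite -addr_eq0 -innerDl addNr inner0l. Qed.

Lemma innerBl x y z : inner (x - y) z = inner x z - inner y z.
Proof. by rewrite innerDl innerNl. Qed.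

Lemma innerDr x y z : inner x (y + z) = inner x y + inner x z.
Proof. by rewrite inner_conj innerDl conjqD -!inner_conj. Qed.

Lemma innerNr x y : inner x (- y) = - inner x y.
Proof. by rewrite inner_conj innerNl conjqN -inner_conj. Qed.

Lemma innerBr x y z : inner x (y - z) = inner x y - inner x z.
Proof. by rewrite innerDr innerNr. Qed.

Lemma innerZr x y q : inner x (rscale y q) = conjq q * inner x y.
Proof. by rewrite inner_conj innerZl conjqM -inner_conj. Qed.

Lemma inner0r x : inner x 0 = 0.
Proof. by rewrite inner_conj inner0l; apply: quat_eq; rewrite /= ?oppr0. Qed.

Lemma hnorm_ge0 x : 0 <= hnorm x. Proof. exact: sqrtr_ge0. Qed.

Lemma sqr_hnorm x : hnorm x ^+ 2 = qre (inner x x).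
Proof. by rewrite sqr_sqrtr ?inner_ge0. Qed.

Lemma inner_self x : inner x x = realq (hnorm x ^+ 2).
Proof.
rewrite sqr_hnorm; have := inner_conj x x.
case: (inner x x) => a b c d [] /= hb hc hd.
by apply: quat_eq => //=; lra.
Qed.

Lemma hnorm_eq0 x : hnorm x = 0 -> x = 0.
Proof. by move=> x0; apply: inner_eq0; rewrite inner_self x0 expr0n. Qed.

Lemma hnorm_rscale x q : hnorm (rscale x q) ^+ 2 = hnorm x ^+ 2 * sqnormq q.
Proof.
rewrite sqr_hnorm innerZl innerZr inner_self -realq_comm -mulrA conjq_mul.
by rewrite realqM.
Qed.

Lemma hnorm1_sqr x : hnorm x ^+ 2 = 1 -> hnorm x = 1.
Proof.
move=> x1; apply/eqP; rewrite -(@eqrXn2 _ 2) ?hnorm_ge0 ?ler01 //.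
by rewrite x1 expr1n.
Qed.

Lemma qre_innerC x y : qre (inner x y) = qre (inner y x).
Proof. by rewrite inner_conj. Qed.

Lemma inner_CauchySchwarz x y : `|qre (inner x y)| <= hnorm x * hnorm y.
Proof.
have [y0|y0] := eqVneq (hnorm y) 0.
  by rewrite (hnorm_eq0 y0) inner0r /= normr0 mulr_ge0 ?hnorm_ge0.
set X := hnorm x; set Y := hnorm y in y0 *; set r := qre (inner x y).
have Y0 : 0 < Y by rewrite lt_def y0 hnorm_ge0.
rewrite -(@ler_pXn2r _ 2) ?nnegrE ?mulr_ge0 ?hnorm_ge0 //.
rewrite real_normK ?num_real //.
(* The squared norm of this vector equals [Y ^+ 2 * (X ^+ 2 * Y ^+ 2 - r ^+ 2)]. *)
have := sqr_ge0 (hnorm (rscale x (realq (Y ^+ 2)) - rscale y (realq r))).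
rewrite sqr_hnorm innerBl !innerBr !innerZl !innerZr !inner_self -/X -/Y.
have : qre (inner y x) = r by exact: qre_innerC.
have : qre (inner x y) = r by [].
move: (inner x y) (inner y x) r => a b r ar br.
rewrite !qreD ?qreN !qreM /= ar br => H.
have : 0 <= Y ^+ 2 * (X ^+ 2 * Y ^+ 2 - r ^+ 2) by apply: le_trans H _; lra.
by rewrite pmulr_rge0 ?exprn_gt0 // exprMn subr_ge0.
Qed.

(** Scaling [x] by a unit quaternion keeps its norm and can move any component of [inner x y] into
    the real part up to sign, so the bound on real parts suffices. *)
Lemma inner_bounds x y (B : R) : hnorm x * hnorm y <= B ->
  [/\ `|qre (inner x y)| <= B, `|qimi (inner x y)| <= B,
      `|qimj (inner x y)| <= B & `|qimk (inner x y)| <= B].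
Proof.
move=> hB.
have rot q : sqnormq q = 1 -> `|qre (inner x y * q)| <= B.
  move=> q1; rewrite -innerZl; apply: le_trans (inner_CauchySchwarz _ _) _.
  suff -> : hnorm (rscale x q) = hnorm x by [].
  apply/eqP; rewrite -(@eqrXn2 _ 2) ?hnorm_ge0 //.
  by rewrite hnorm_rscale q1 mulr1.
split.
- by rewrite -[inner x y]mulr1; apply: rot; rewrite /sqnormq /=; ring.
- rewrite -normrN -[- _](_ : qre (inner x y * Quat 0 1 0 0) = _).
    by apply: rot; rewrite /sqnormq /=; ring.
  by rewrite qreM /=; ring.
- rewrite -normrN -[- _](_ : qre (inner x y * Quat 0 0 1 0) = _).
    by apply: rot; rewrite /sqnormq /=; ring.
  by rewrite qreM /=; ring.
- rewrite -normrN -[- _](_ : qre (inner x y * Quat 0 0 0 1) = _).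
    by apply: rot; rewrite /sqnormq /=; ring.
  by rewrite qreM /=; ring.
Qed.

Lemma hnorm_triangle x y : hnorm (x + y) <= hnorm x + hnorm y.
Proof.
rewrite -(@ler_pXn2r _ 2) ?nnegrE ?addr_ge0 ?hnorm_ge0 //.
rewrite sqr_hnorm innerDl !innerDr !inner_self /= ?quatE /= (qre_innerC y x).
by have := inner_CauchySchwarz x y; rewrite ler_norml => /andP[_]; lra.
Qed.

Lemma hnorm_opp x : hnorm (- x) = hnorm x.
Proof. by rewrite /hnorm innerNl innerNr opprK. Qed.

End InnerProduct.

(** * A scalar inequality balancing weights against imaginary parts *)

Section PolygonInequality.
Variable R : realType.

(** Cauchy-Schwarz in three dimensions, from Lagrange's identity for the cross product. *)
Lemma dot_ge_opp (u1 u2 u3 v1 v2 v3 t : R) : 0 <= t ->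
  u1 ^+ 2 + u2 ^+ 2 + u3 ^+ 2 <= 1 -> v1 ^+ 2 + v2 ^+ 2 + v3 ^+ 2 = t ^+ 2 ->
  - t <= u1 * v1 + u2 * v2 + u3 * v3.
Proof.
move=> t0 u1_le vt; set d := _ + u3 * v3.
suff : d ^+ 2 <= t ^+ 2.
  rewrite -[d ^+ 2]real_normK ?num_real // ler_pXn2r ?nnegrE //.
  by rewrite ler_norml => /andP[].
have := sqr_ge0 (u1 * v2 - u2 * v1); have := sqr_ge0 (u1 * v3 - u3 * v1).
have := sqr_ge0 (u2 * v3 - u3 * v2).
have : 0 <= (1 - (u1 ^+ 2 + u2 ^+ 2 + u3 ^+ 2)) * t ^+ 2.
  by rewrite mulr_ge0 ?sqr_ge0 ?subr_ge0.
by rewrite -vt /d; lra.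
Qed.

Definition dot_im (u q : quat R) : R :=
  qimi u * qimi q + qimj u * qimj q + qimk u * qimk q.

Lemma dot_im_sum (u : quat R) (n : nat) (F : 'I_n -> quat R) :
  dot_im u (\sum_(k < n) F k) = \sum_(k < n) dot_im u (F k).
Proof.
elim/big_rec2: _ => [|i a b _ <-]; first by rewrite /dot_im /= !mulr0 !addr0.
by rewrite /dot_im /=; ring.
Qed.

Lemma qre_sum (n : nat) (F : 'I_n -> quat R) :
  qre (\sum_(k < n) F k) = \sum_(k < n) qre (F k).
Proof. by elim/big_rec2: _ => // i a b _ <-. Qed.

(** The imaginary part of [conjq x * complexq h s * x] is a rotated and scaled copy of s i, of
    length [s * sqnormq x]. *)
Lemma dot_im_ge_opp (u x : quat R) (h s : R) : 0 <= s ->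
  qimi u ^+ 2 + qimj u ^+ 2 + qimk u ^+ 2 <= 1 ->
  - (s * sqnormq x) <= dot_im u (conjq x * complexq h s * x).
Proof.
move=> s0 u1; apply: dot_ge_opp => //; first by rewrite mulr_ge0 ?sqnormq_ge0.
by case: x => a b c d; rewrite /sqnormq /= ?quatE /=; ring.
Qed.

(* At most one weight can be negative; the direction [u] is chosen along its
   imaginary part, the others are dominated by their [s k]. *)
Lemma polygon_bound (g h s : nat -> R) : (forall k, 0 <= s k) ->
  (forall k, s k = 0 -> 0 <= g k) ->
  (forall k j, k != j -> 0 <= s j * g k + s k * g j) ->
  exists2 lam : R, 0 <= lam & forall x : nat -> quat R,
    exists2 u : quat R, qimi u ^+ 2 + qimj u ^+ 2 + qimk u ^+ 2 <= 1 &
    forall k, 0 <= g k * sqnormq (x k) +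
      lam * dot_im u (conjq (x k) * complexq (h k) (s k) * x k).
Proof.
move=> s0 g0 gg.
have [[k0 gk0]|gpos] := pselect (exists k, g k < 0); last first.
  exists 0 => // x; exists 0 => [|k]; first by rewrite /= !expr0n /= !addr0.
  rewrite mul0r addr0 mulr_ge0 ?sqnormq_ge0 // leNgt.
  by apply/negP => gk; apply: gpos; exists k.
have sk0 : 0 < s k0.
  rewrite lt_def s0 andbT; apply/eqP => /g0; lra.
(* This [lam] turns the negative weight into [- (lam * s k0)], exactly what the imaginary part of
   term [k0] gives back when [u] points along it. It does not depend on [x]. *)
have lam0 : 0 <= - g k0 / s k0 by rewrite divr_ge0 // oppr_ge0 ltW.
exists (- g k0 / s k0) => // x.
set lam := - g k0 / s k0 in lam0 *.
have gE : g k0 = - (lam * s k0) by rewrite /lam divfK ?gt_eqF // opprK.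
have [u u1 uk0] : exists2 u : quat R,
    qimi u ^+ 2 + qimj u ^+ 2 + qimk u ^+ 2 <= 1 &
    dot_im u (conjq (x k0) * complexq (h k0) (s k0) * x k0) =
    s k0 * sqnormq (x k0).
  have [->|x0] := eqVneq (x k0) 0.
    exists 0; first by rewrite /= !expr0n /= !addr0 ler01.
    by rewrite !mulr0 /dot_im /sqnormq /= !expr0n /= !(mulr0, addr0).
  have N0 : sqnormq (x k0) != 0 by apply: contra x0 => /eqP/sqnormq_eq0 ->.
  (* [w] has length [sqnormq (x k0)], so dividing by that number gives a unit direction along the
     imaginary part of term [k0]. *)
  pose w := conjq (x k0) * complexq 0 1 * x k0.
  exists (realq (sqnormq (x k0))^-1 * w).
    suff -> : qimi (realq (sqnormq (x k0))^-1 * w) ^+ 2 +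
      qimj (realq (sqnormq (x k0))^-1 * w) ^+ 2 +
      qimk (realq (sqnormq (x k0))^-1 * w) ^+ 2 = 1 by [].
    transitivity (((sqnormq (x k0))^-1 * sqnormq (x k0)) ^+ 2).
      rewrite /w /=; move: (_^-1) => r; case: (x k0) => a b c d.
      by rewrite /sqnormq /= ?quatE /=; ring.
    by rewrite mulVf // expr1n.
  transitivity (((sqnormq (x k0))^-1 * sqnormq (x k0)) *
                (s k0 * sqnormq (x k0))).
    rewrite /w /=; move: (_^-1) (h k0) (s k0) => r h1 s1.
    by case: (x k0) => a b c d; rewrite /dot_im /sqnormq /= ?quatE /=; ring.
  by rewrite mulVf // mul1r.
exists u => // k.
have [->|kk0] := eqVneq k k0; first by rewrite uk0 gE; lra.
have := dot_im_ge_opp (x k) (h k) (s0 k) u1.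
set w := dot_im _ _ => hw.
(* The pair condition for [k] and [k0] reads [0 <= s k0 * (g k - lam * s k)]. *)
have gk : lam * s k <= g k.
  have := gg _ _ kk0; rewrite gE => H.
  by rewrite -(ler_pM2l sk0); lra.
have h1 : 0 <= lam * (w + s k * sqnormq (x k)) by rewrite mulr_ge0 //; lra.
have h2 : 0 <= (g k - lam * s k) * sqnormq (x k).
  by rewrite mulr_ge0 ?sqnormq_ge0 ?subr_ge0.
lra.
Qed.

End PolygonInequality.

(** * Quadratic forms of bounded and of diagonal operators *)

Section DiagonalForm.
Variables (R : realType) (V : rightQuatHilbertType R).
Implicit Types (x y z : V) (A D : {linear V -> V}).

Lemma linear_rscale A x q : A (rscale x q) = rscale (A x) q.
Proof. exact: linearZ. Qed.

Lemma form_bounds A (M : R) x y (B : R) :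
  (forall z, hnorm (A z) <= M * hnorm z) -> M * hnorm x * hnorm y <= B ->
  [/\ `|qre (inner (A x) y)| <= B, `|qimi (inner (A x) y)| <= B,
      `|qimj (inner (A x) y)| <= B & `|qimk (inner (A x) y)| <= B].
Proof.
move=> AM hB; apply: inner_bounds; apply: le_trans hB.
by rewrite ler_wpM2r ?hnorm_ge0.
Qed.

(** With [w = y - y'], the difference of the forms is [inner (A w) y + inner (A y') w], and
    [hnorm y' <= hnorm y + 1]. This local Lipschitz bound carries estimates from finite basis sums
    to their limits. *)
Lemma form_perturb A y : bounded_op A -> exists2 K : R, 0 <= K &
  forall y', hnorm (y - y') <= 1 ->
  let q := inner (A y) y - inner (A y') y' in
  [/\ `|qre q| <= K * hnorm (y - y'), `|qimi q| <= K * hnorm (y - y'),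
      `|qimj q| <= K * hnorm (y - y') & `|qimk q| <= K * hnorm (y - y')].
Proof.
move=> [M0 AM0]; pose M := `|M0|.
have M_ge0 : 0 <= M by exact: normr_ge0.
have AM z : hnorm (A z) <= M * hnorm z.
  by apply: le_trans (AM0 z) _; rewrite ler_wpM2r ?hnorm_ge0 ?ler_norm.
have y0 := hnorm_ge0 y.
exists (M * (2 * hnorm y + 1)); first by rewrite mulr_ge0 //; lra.
move=> y' yy' q; set w := y - y' in yy' *.
have -> : q = inner (A w) y + inner (A y') w.
  by rewrite /q /w linearB innerBl innerBr addrA subrK.
have w0 := hnorm_ge0 w.
have y'_le : hnorm y' <= hnorm y + 1.
  have -> : y' = y + (- w) by rewrite /w opprB addrC subrK.
  by apply: le_trans (hnorm_triangle _ _) _; rewrite hnorm_opp lerD2l.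
have [a1 a2 a3 a4] : [/\ `|qre (inner (A w) y)| <= M * hnorm y * hnorm w,
    `|qimi (inner (A w) y)| <= M * hnorm y * hnorm w,
    `|qimj (inner (A w) y)| <= M * hnorm y * hnorm w &
    `|qimk (inner (A w) y)| <= M * hnorm y * hnorm w].
  by apply: (form_bounds AM); rewrite mulrAC.
have [b1 b2 b3 b4] : [/\
    `|qre (inner (A y') w)| <= M * (hnorm y + 1) * hnorm w,
    `|qimi (inner (A y') w)| <= M * (hnorm y + 1) * hnorm w,
    `|qimj (inner (A y') w)| <= M * (hnorm y + 1) * hnorm w &
    `|qimk (inner (A y') w)| <= M * (hnorm y + 1) * hnorm w].
  by apply: (form_bounds AM); rewrite ler_wpM2r // ler_wpM2l.
have -> : M * (2 * hnorm y + 1) * hnorm w =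
  M * hnorm y * hnorm w + M * (hnorm y + 1) * hnorm w by ring.
by split; apply: le_trans (ler_normD _ _) _; apply: lerD.
Qed.

Variables (e : nat -> V) (e_basis : orthonormal_basis e).

Lemma inner_basis_sum (x : nat -> quat R) n k : (k < n)%N ->
  inner (e k) (\sum_(i < n) rscale (e i) (x i)) = conjq (x k).
Proof.
move=> kn; rewrite inner_conj inner_suml (bigD1 (Ordinal kn)) //= big1.
  by rewrite addr0 innerZl e_basis.1 eqxx mul1r.
move=> i /eqP ik; rewrite innerZl e_basis.1.
have -> : (val i == k) = false by apply/eqP => ik'; apply: ik; apply: val_inj.
by rewrite mul0r.
Qed.

Lemma diag_form_sum A (d : nat -> quat R) (x : nat -> quat R) n :
  (forall k, A (e k) = rscale (e k) (d k)) ->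
  let y := \sum_(i < n) rscale (e i) (x i) in
  inner (A y) y = \sum_(k < n) conjq (x k) * d k * x k.
Proof.
move=> Ae y; rewrite {1}/y linear_sum inner_suml; apply: eq_bigr => k _.
by rewrite linear_rscale Ae rscaleM innerZl inner_basis_sum // mulrA.
Qed.

Lemma hnorm_basis_sum (x : nat -> quat R) n :
  hnorm (\sum_(i < n) rscale (e i) (x i)) ^+ 2 = \sum_(k < n) sqnormq (x k).
Proof.
rewrite sqr_hnorm inner_suml qre_sum; apply: eq_bigr => k _.
by rewrite innerZl inner_basis_sum // conjq_mul.
Qed.

(** [polygon_bound] with weights [sg * h k - m] gives one [lam] for all coefficient sequences. Its
    termwise inequalities add up over finite basis sums, and continuity of the form extends the
    result to every [y]. The values 1 and -1 of [sg] serve the infimum and the supremum. *)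
Lemma diag_form_bound D (h s : nat -> R) (sg m : R) : bounded_op D ->
  (forall k, 0 <= s k) ->
  (forall k, D (e k) = rscale (e k) (complexq (h k) (s k))) ->
  (forall k, s k = 0 -> m <= sg * h k) ->
  (forall k j, k != j -> 0 <= s j * (sg * h k - m) + s k * (sg * h j - m)) ->
  exists2 lam : R, 0 <= lam & forall y q, q = inner (D y) y ->
    m * hnorm y ^+ 2 <=
      sg * qre q + lam * (`|qimi q| + `|qimj q| + `|qimk q|).
Proof.
move=> Dbd s0 De hm hkj.
have [||lam lam0 lamP] := @polygon_bound _ (fun k => sg * h k - m) h s s0.
- by move=> k /hm; rewrite subr_ge0.
- exact: hkj.
exists lam => // y q qE.
have [K K0 KP] := form_perturb y Dbd.
(* The squared norm is the quadratic form of the identity. *)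
have [K' K'0 KP'] : exists2 K : R, 0 <= K & forall y', hnorm (y - y') <= 1 ->
    `|hnorm y ^+ 2 - hnorm y' ^+ 2| <= K * hnorm (y - y').
  have [|K' K'0 K'P] := @form_perturb (idfun : {linear V -> V}) y.
    by exists 1 => z; rewrite mul1r.
  by exists K' => // y' /K'P[]; rewrite /= !sqr_hnorm.
apply/ler_addgt0Pr => eps eps0.
(* The total error rate: the real part, the three imaginary components, and the squared norm.
   Dividing by [C + 1] below avoids a zero denominator. *)
pose C := `|sg| * K + lam * (3 * K) + `|m| * K'.
have C0 : 0 <= C by rewrite !addr_ge0 ?mulr_ge0 ?normr_ge0.
have [n ny] : exists n,
    hnorm (y - \sum_(k < n) rscale (e k) (inner y (e k))) <=
    Num.min 1 (eps / (C + 1)).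
  have del0 : 0 < Num.min 1 (eps / (C + 1)).
    by rewrite lt_min ltr01 divr_gt0 // ltr_wpDl.
  have /cvgrPdist_le/(_ _ del0)[N _ /(_ N (leqnn N))] := e_basis.2 y.
  rewrite sub0r normrN ger0_norm ?hnorm_ge0 // => hN; exists N.
  by rewrite -hnorm_opp opprB.
set y' := \sum_(k < n) _ in ny.
move: ny; rewrite le_min => /andP[ny1 nye].
have {KP} [] := KP y' ny1; have {KP'} := KP' y' ny1.
have := hnorm_ge0 (y - y').
set del := hnorm (y - y') in nye *.
set q' := inner (D y') y'; rewrite -qE => del0 N1 Q1 Q2 Q3 Q4.
have fin : m * hnorm y' ^+ 2 <=
    sg * qre q' + lam * (`|qimi q'| + `|qimj q'| + `|qimk q'|).
  (* A single direction [u] serves all the terms, so the inequalities can be summed. *)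
  have [u u1 uP] := lamP (fun k => inner y (e k)).
  rewrite /q' /y' (hnorm_basis_sum (fun k => inner y (e k)))
    (diag_form_sum (fun k => inner y (e k)) _ De).
  set S := \sum_(k < n) (_ * _ * _).
  have SP : 0 <= sg * qre S - m * (\sum_(k < n) sqnormq (inner y (e k))) +
      lam * dot_im u S.
    have := @sumr_ge0 _ _ (index_enum 'I_n) xpredT _ (fun k _ => uP k).
    rewrite big_split /= -mulr_sumr -dot_im_sum -/S.
    congr (0 <= _ + _); rewrite qre_sum !mulr_sumr -sumrB.
    by apply: eq_bigr => k _; rewrite /sqnormq /= ?quatE /=; ring.
  suff : dot_im u S <= `|qimi S| + `|qimj S| + `|qimk S|.
    by move=> /(ler_wpM2l lam0); lra.
  have le1 (a b c : R) : a ^+ 2 + b ^+ 2 + c ^+ 2 <= 1 -> `|a| <= 1.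
    rewrite -[`|a| <= 1](@ler_pXn2r _ 2) ?nnegrE ?normr_ge0 ?ler01 //.
    rewrite expr1n real_normK ?num_real //.
    by have := sqr_ge0 b; have := sqr_ge0 c; lra.
  have mul_le (a b : R) : `|a| <= 1 -> a * b <= `|b|.
    move=> a1; apply: le_trans (ler_norm _) _; rewrite normrM.
    by rewrite -[leRHS]mul1r ler_wpM2r.
  rewrite /dot_im !lerD // mul_le //.
  - exact: le1 u1.
  - by apply: (@le1 _ (qimi u) (qimk u)); rewrite [X in X + _ <= _]addrC.
  - by apply: (@le1 _ (qimi u) (qimj u)); rewrite -addrA addrC.
have C1 : C * del <= eps.
  have : (C + 1) * del <= eps by rewrite mulrC -ler_pdivlMr // ltr_wpDl.
  lra.
have c1 : m * hnorm y ^+ 2 <= m * hnorm y' ^+ 2 + `|m| * K' * del.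
  rewrite -lerBlDl -mulrBr; apply: le_trans (ler_norm _) _.
  by rewrite normrM -mulrA ler_wpM2l.
have c2 : sg * qre q' <= sg * qre q + `|sg| * K * del.
  rewrite -lerBlDl -mulrBr; apply: le_trans (ler_norm _) _.
  by rewrite normrM -mulrA ler_wpM2l // distrC.
have c3 (a b : R) : `|a - b| <= K * del -> `|b| <= `|a| + K * del.
  move=> ab; rewrite -lerBlDl; apply: le_trans ab.
  by rewrite distrC; apply: lerB_dist.
have {c3} c4 := lerD (lerD (c3 _ _ Q2) (c3 _ _ Q3)) (c3 _ _ Q4).
have {c4} c5 := ler_wpM2l lam0 c4.
rewrite /C in C1; lra.
Qed.

End DiagonalForm.

(** * Adjoints, normality, and the construction of real points of the bild *)

Section NormalForm.
Variables (R : realType) (V : rightQuatHilbertType R).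
Implicit Types (x y z v : V) (S : V -> V) (U T D : {linear V -> V}).

Lemma adjoint_isometry U S x : is_adjoint U S -> S \o U =1 id ->
  hnorm (U x) = hnorm x.
Proof.
by move=> US SU; rewrite /hnorm US; have /= -> := SU x.
Qed.

Lemma adjoint_coisometry U S x : is_adjoint U S -> U \o S =1 id ->
  hnorm (S x) = hnorm x.
Proof.
by move=> US UxS; rewrite /hnorm -US; have /= -> := UxS x.
Qed.

Lemma opnorm_ge (E : V -> V) x : bounded_op E -> hnorm x <= 1 ->
  hnorm (E x) <= opnorm E.
Proof.
move=> [M EM] x1; apply: ub_le_sup; last by exists x.
exists `|M| => _ [y y1 <-]; apply: le_trans (EM y) _.
apply: le_trans (ler_norm _) _; rewrite normrM -[leRHS]mulr1 ler_wpM2l //.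
by rewrite ger0_norm ?hnorm_ge0.
Qed.

(** Since [S] is adjoint to [U], the form of [U D S] at [x] is the form of [D] at [S x], so
    closeness in operator norm becomes closeness of the forms on unit vectors. *)
Lemma approx_unitary T D : bounded_op T -> bounded_op D ->
  approx_unitarily_equiv T D -> forall eps : R, 0 < eps ->
  exists (U : {linear V -> V}) (S : V -> V), unitary_with_adjoint U S /\
    forall x, hnorm x = 1 ->
      let q := inner (D (S x)) (S x) - inner (T x) x in
      [/\ `|qre q| <= eps, `|qimi q| <= eps, `|qimj q| <= eps &
          `|qimk q| <= eps].
Proof.
move=> [MT TM] [MD DM] [U [S [US Ulim]]] eps eps0.
have /cvgrPdist_le/(_ _ eps0)[N _ /(_ N (leqnn N))] := Ulim.
rewrite sub0r normrN => hN.
exists (U N), (S N); split=> // x x1 q.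
have [_ adj SU UxS] := US N.
have -> : q = inner (U N (D (S N x)) - T x) x by rewrite innerBl adj.
apply: inner_bounds; rewrite x1 mulr1.
apply: le_trans (le_trans _ (ler_norm _)) hN.
apply: (@opnorm_ge (fun x => U N (D (S N x)) - T x)); last by rewrite x1.
(* Boundedness of the difference makes the supremum in [opnorm] a genuine upper bound; [U N] and
   [S N] preserve norms. *)
exists (MD + MT) => y; apply: le_trans (hnorm_triangle _ _) _.
rewrite hnorm_opp (adjoint_isometry _ adj SU) mulrDl lerD //.
by apply: le_trans (DM _) _; rewrite (adjoint_coisometry _ adj UxS).
Qed.

Lemma bild_real T (a : R) :
  real_part_of (bild T) a <-> exists2 x, hnorm x = 1 & inner (T x) x = realq a.
Proof.
by split=> [[[x x1 xa] _]|[x x1 xa]]; [exists x | split=> //; exists x].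
Qed.

(** Normality makes [S v] and [T v] equally long, and then the squared norm of
    [S v - rscale v (conjq q)] expands to zero. Hence [T] preserves the orthogonal complement of an
    eigenvector. *)
Lemma adjoint_eigen T S v (q : quat R) : is_adjoint T S -> S \o T =1 T \o S ->
  T v = rscale v q -> S v = rscale v (conjq q).
Proof.
move=> TS comm Tv.
have Svv : inner (S v) v = conjq q * inner v v.
  by rewrite inner_conj -TS Tv innerZl conjqM -inner_conj.
have SvSv : inner (S v) (S v) = conjq q * inner v v * q.
  rewrite -TS; have /= <- := comm v.
  by rewrite inner_conj -TS Tv innerZl innerZr !conjqM conjqK -inner_conj mulrA.
apply/eqP; rewrite -subr_eq0; apply/eqP/inner_eq0.
rewrite innerBl !innerBr SvSv !innerZl !innerZr Svv conjqK.
rewrite [inner v (S v)]inner_conj Svv conjqM conjqK -inner_conj.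
rewrite inner_self; move: (hnorm v ^+ 2) => r.
by apply: quat_eq; rewrite /= ?quatE /=; ring.
Qed.

(** With vanishing cross terms, weights sqrt(1 - t) and sqrt t give the form value (1 - t)(h + s i)
    + t (h' - p i), and the balance condition removes its i-component. *)
Lemma bild_mix T v z (h s h' p t : R) :
  hnorm v = 1 -> hnorm z = 1 -> inner v z = 0 ->
  inner (T v) z = 0 -> inner (T z) v = 0 ->
  inner (T v) v = complexq h s -> inner (T z) z = complexq h' (- p) ->
  0 <= t -> t <= 1 -> (1 - t) * s = t * p ->
  real_part_of (bild T) ((1 - t) * h + t * h').
Proof.
move=> v1 z1 vz Tvz Tzv Tvv Tzz t0 t1 tsp; apply/bild_real.
pose a := Num.sqrt (1 - t); pose b := Num.sqrt t.
have a2 : a * a = 1 - t by rewrite -expr2 sqr_sqrtr // subr_ge0.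
have b2 : b * b = t by rewrite -expr2 sqr_sqrtr.
exists (rscale v (realq a) + rscale z (realq b)).
  apply: hnorm1_sqr.
  rewrite sqr_hnorm innerDl !innerDr !innerZl !innerZr !inner_self v1 z1 vz.
  have -> : inner z v = 0.
    by rewrite inner_conj vz; apply: quat_eq; rewrite /= ?oppr0.
  rewrite /= ?quatE /= ?expr1n; transitivity (a * a + b * b); first by ring.
  by rewrite a2 b2 subrK.
rewrite linearD !linear_rscale innerDl !innerDr !innerZl !innerZr.
rewrite Tvv Tzz Tvz Tzv.
apply: quat_eq; rewrite /= ?quatE /=; try by ring.
  by rewrite -a2 -b2; ring.
transitivity (a * a * s - b * b * p); first by ring.
by rewrite a2 b2 tsp subrr.
Qed.

Lemma unit_rscale x : x != 0 -> exists r : R, hnorm (rscale x (realq r)) = 1.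
Proof.
move=> x0; have n0 : hnorm x != 0 by apply: contra x0 => /eqP/hnorm_eq0 ->.
exists (hnorm x)^-1; apply: hnorm1_sqr; rewrite hnorm_rscale /sqnormq /=.
by rewrite expr0n /= !addr0 -exprMn divff // expr1n.
Qed.

Lemma right_eigenvalue_unit T (q : quat R) : right_eigenvalues T q ->
  exists2 v, hnorm v = 1 & T v = rscale v q.
Proof.
move=> [x /unit_rscale[r r1] Tx]; exists (rscale x (realq r)) => //.
by rewrite linear_rscale Tx !rscaleM realq_comm.
Qed.

(** For nonzero [p], the pair [- (conjq p * q)], [realq (sqnormq p)] solves the equation, because
    [p * conjq p] is real; it is then normalised. It serves to find a unit vector orthogonal to a
    given one in the span of two basis vectors. *)
Lemma quat_line_meet (p q : quat R) :
  exists a b : quat R, sqnormq a + sqnormq b = 1 /\ p * a + q * b = 0.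
Proof.
have [->|p0] := eqVneq p 0.
  exists 1, 0; rewrite mul0r mulr0 addr0; split=> //.
  by rewrite /sqnormq /=; ring.
have N0 : sqnormq p != 0 by apply: contra p0 => /eqP/sqnormq_eq0 ->.
pose a := - (conjq p * q); pose b := realq (sqnormq p).
have M0 : 0 < sqnormq a + sqnormq b.
  rewrite ltr_wpDl ?sqnormq_ge0 // lt_def sqnormq_ge0 andbT.
  by apply: contra N0 => /eqP/sqnormq_eq0[->].
pose r := (Num.sqrt (sqnormq a + sqnormq b))^-1.
have r2 : r ^+ 2 * (sqnormq a + sqnormq b) = 1.
  by rewrite exprVn sqr_sqrtr ?ltW // mulVf // gt_eqF.
exists (a * realq r), (b * realq r); split.
  by rewrite -[RHS]r2; case: (a) (b) => ? ? ? ? [] ? ? ? ?;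
    rewrite /sqnormq /= ?quatE /=; ring.
rewrite !mulrA -mulrDl; have -> : p * a + q * b = 0; last by rewrite mul0r.
by rewrite /a /b /sqnormq; apply: quat_eq; rewrite /= ?quatE /=; ring.
Qed.

Lemma bild_near_same T S D (e : nat -> V) (h s : R) k j v (eps : R) :
  bounded_op T -> bounded_op D -> approx_unitarily_equiv T D ->
  is_adjoint T S -> S \o T =1 T \o S ->
  hnorm v = 1 -> T v = rscale v (complexq h s) -> 0 <= s ->
  orthonormal_basis e -> k != j ->
  D (e k) = rscale (e k) (complexq h s) ->
  D (e j) = rscale (e j) (complexq h s) -> 0 < eps ->
  exists2 a, real_part_of (bild T) a & `|a - h| <= eps.
Proof.
move=> Tbd Dbd TD TS comm v1 Tv s0 [eo _] kj Dk Dj eps0.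
have Tvv : inner (T v) v = complexq h s.
  by rewrite Tv innerZl inner_self v1 expr1n mul1r.
(* A real eigenvalue is attained at [v] itself; otherwise [s + p] below is positive. *)
have [s00|s_neq0] := eqVneq s 0.
  exists h; last by rewrite subrr normr0 ltW.
  by apply/bild_real; exists v => //; rewrite Tvv s00.
have [U [S' [[_ US SU _] near]]] := approx_unitary Tbd Dbd TD eps0.
(* Orthogonality of the combination to [S' v] is orthogonality of its image under [U] to [v]. *)
have [a [b [ab1 ab0]]] :=
  quat_line_meet (inner (e k) (S' v)) (inner (e j) (S' v)).
pose z' := rscale (e k) a + rscale (e j) b.
have ekk : inner (e k) (e k) = 1 by rewrite eo eqxx.
have ejj : inner (e j) (e j) = 1 by rewrite eo eqxx.
have ekj : inner (e k) (e j) = 0 by rewrite eo (negbTE kj).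
have ejk : inner (e j) (e k) = 0 by rewrite eo eq_sym (negbTE kj).
have z'1 : hnorm z' = 1.
  apply: hnorm1_sqr; rewrite sqr_hnorm /z' innerDl !innerDr !innerZl !innerZr.
  rewrite ekk ejj ekj ejk !mulr0 !mul0r !mulr1 !addr0 !add0r !conjq_mul.
  by rewrite -[RHS]ab1.
(* Only the imaginary part of [conjq a * complexq h s * a] depends on the direction of [a]; the real
   parts add up to [h] times 1. *)
have reDz' : qre (inner (D z') z') = h.
  rewrite /z' linearD !linear_rscale Dk Dj !rscaleM.
  rewrite innerDl !innerDr !innerZl !innerZr.
  rewrite ekk ejj ekj ejk !mulr0 !mul0r !mulr1 !addr0 !add0r.
  transitivity (h * (sqnormq a + sqnormq b)); last by rewrite ab1 mulr1.
  by rewrite /sqnormq /= ?quatE /=; ring.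
pose z := U z'.
have z1 : hnorm z = 1 by rewrite (adjoint_isometry _ US SU).
have zv : inner z v = 0 by rewrite US /z' innerDl !innerZl ab0.
have [near_re _ _ _] := near z z1.
have S'z : S' z = z' by have := SU z'.
rewrite S'z qreD qreN reDz' distrC in near_re.
have [u [p p0 [u1 uP]]] := rotate_to_lower_half (inner (T z) z).
pose z0 := rscale z u.
have z01 : hnorm z0 = 1.
  by apply: hnorm1_sqr; rewrite hnorm_rscale z1 u1 expr1n mul1r.
have z0v : inner z0 v = 0 by rewrite innerZl zv mul0r.
have vz0 : inner v z0 = 0.
  by rewrite inner_conj z0v; apply: quat_eq; rewrite /= ?oppr0.
have sp0 : 0 < s + p by rewrite ltr_pwDl // lt_def s_neq0.
(* The solution of [(1 - t) * s = t * p]. *)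
pose t := s / (s + p).
have t0 : 0 <= t by rewrite divr_ge0 // ltW.
have t1 : t <= 1 by rewrite ler_pdivrMr // mul1r lerDl.
set h' := qre _ in near_re uP.
exists ((1 - t) * h + t * h').
  apply: (@bild_mix T v z0 h s h' p t) => //.
  - by rewrite Tv innerZl vz0 mul0r.
  - by rewrite TS (adjoint_eigen TS comm Tv) innerZr z0v mulr0.
  - by rewrite linear_rscale innerZl innerZr uP.
  - by rewrite /t; field; rewrite gt_eqF.
have -> : (1 - t) * h + t * h' - h = t * (h' - h) by ring.
rewrite normrM ger0_norm //; apply: le_trans near_re.
by rewrite -[leRHS]mul1r ler_wpM2r.
Qed.

(** [inner v w] intertwines the two eigenvalues, so it vanishes when they differ. Replacing [w] by
    its multiple by j conjugates its eigenvalue and supplies the opposite imaginary part. *)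
Lemma bild_distinct T S (h s h' s' t : R) v w :
  is_adjoint T S -> S \o T =1 T \o S -> 0 <= s -> 0 <= s' ->
  hnorm v = 1 -> T v = rscale v (complexq h s) ->
  hnorm w = 1 -> T w = rscale w (complexq h' s') ->
  ~ (h = h' /\ s = s') -> 0 <= t -> t <= 1 -> (1 - t) * s = t * s' ->
  real_part_of (bild T) ((1 - t) * h + t * h').
Proof.
move=> TS comm s0 s'0 v1 Tv w1 Tw dd t0 t1 tss.
have vw : inner v w = 0.
  apply/eqP/negP => /negP vw0; apply: dd.
  apply: (intertwined_eq s0 s'0 vw0).
  by rewrite -innerZl -Tv TS (adjoint_eigen TS comm Tw) innerZr conjqK.
pose j := Quat 0 0 1 0 : quat R.
have wj0 : inner v (rscale w j) = 0 by rewrite innerZr vw mulr0.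
have wv0 : inner (rscale w j) v = 0.
  by rewrite inner_conj wj0; apply: quat_eq; rewrite /= ?oppr0.
apply: (@bild_mix T v (rscale w j) h s h' s' t) => //.
- apply: hnorm1_sqr; rewrite hnorm_rscale w1 /sqnormq /=; ring.
- by rewrite Tv innerZl wj0 mul0r.
- by rewrite TS (adjoint_eigen TS comm Tv) innerZr wv0 mulr0.
- by rewrite Tv innerZl inner_self v1 expr1n mul1r.
- rewrite linear_rscale Tw innerZl innerZr innerZl inner_self w1 expr1n.
  by apply: quat_eq; rewrite /= ?quatE /=; ring.
Qed.

End NormalForm.

(** * Real points of a segment joining the upper and lower half-planes *)

Section RealSegments.
Variable R : realType.
Implicit Types (h s c t : R).

Lemma real_segmentP h s h' s' c :
  real_part_of (segment (complexq h s) (conjq (complexq h' s'))) c <->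
  exists t, [/\ 0 <= t, t <= 1, c = (1 - t) * h + t * h' &
    (1 - t) * s = t * s'].
Proof.
split=> [[t /=]|[t [t0 t1 cE tE]]].
  rewrite in_itv /= => /andP[t0 t1] E; exists t.
  have := congr1 (@qre R) E; have := congr1 (@qimi R) E.
  by rewrite /= ?quatE /= => E2 E1; split=> //; lra.
exists t; first by rewrite /= in_itv /= t0 t1.
apply: quat_eq; rewrite /= ?quatE /= ?cE; try by ring.
transitivity ((1 - t) * s - t * s'); first by ring.
by rewrite tE subrr.
Qed.

(** The endpoints lie on opposite closed sides of the real axis and not both on it, so the segment
    crosses it once, at parameter [s / (s + s')]. *)
Lemma real_segment_single h s h' s' : 0 <= s -> 0 <= s' -> 0 < s + s' ->
  real_part_of (segment (complexq h s) (conjq (complexq h' s'))) =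
  [set (s' * h + s * h') / (s + s')].
Proof.
move=> s0 s'0 ss; have ss0 : s + s' != 0 by rewrite gt_eqF.
apply/seteqP; split=> c.
  move=> /real_segmentP[t [_ _ -> tE]].
  have -> /= : t = s / (s + s') by apply: (mulIf ss0); rewrite divfK //; lra.
  by field.
move=> ->; apply/real_segmentP; exists (s / (s + s')); split.
- by rewrite divr_ge0 // ltW.
- by rewrite ler_pdivrMr // mul1r lerDl.
- by field.
- by field.
Qed.

(** Ensures that [min_elt] and [max_elt] never take their default value: the real points are a
    single crossing or, for two real endpoints, the whole interval between [h] and [h']. *)
Lemma real_segment_extrema h s h' s' : 0 <= s -> 0 <= s' ->
  let A := real_part_of (segment (complexq h s) (conjq (complexq h' s'))) in
  (A (min_elt A) /\ lbound A (min_elt A)) /\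
  (A (max_elt A) /\ ubound A (max_elt A)).
Proof.
move=> s0 s'0 A.
suff [m [M [mA MA]]] : exists m M, [set m | A m /\ lbound A m] m /\
    [set m | A m /\ ubound A m] M.
  split; [exact: (xgetPex 0 (ex_intro _ m mA))|].
  exact: (xgetPex 0 (ex_intro _ M MA)).
have := addr_ge0 s0 s'0; rewrite le_eqVlt => /orP[/eqP/esym ss|ss]; last first.
  rewrite /A real_segment_single //; set c := _ / _.
  by exists c, c; split; split=> // _ ->.
have {ss} [ss0 ss'0] : s = 0 /\ s' = 0 by lra.
have Ah : A h.
  apply/real_segmentP; exists 0.
  by split; rewrite ?ss0 ?ss'0 ?lexx ?ler01 //; ring.
have Ah' : A h'.
  apply/real_segmentP; exists 1.
  by split; rewrite ?ss0 ?ss'0 ?lexx ?ler01 //; ring.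
exists (Num.min h h'), (Num.max h h'); split; split.
- by case: (leP h h').
- move=> _ /real_segmentP[t [t0 t1 -> _]]; rewrite ge_min.
  have [hh|hh] := leP h h'; apply/orP; [left|right].
    have : 0 <= t * (h' - h) by rewrite mulr_ge0 // subr_ge0.
    lra.
  have : 0 <= (1 - t) * (h - h') by rewrite mulr_ge0 // subr_ge0 // ltW.
  lra.
- by case: (leP h h').
- move=> _ /real_segmentP[t [t0 t1 -> _]]; rewrite le_max.
  have [hh|hh] := leP h h'; apply/orP; [right|left].
    have : 0 <= (1 - t) * (h' - h) by rewrite mulr_ge0 // subr_ge0.
    lra.
  have : 0 <= t * (h - h') by rewrite mulr_ge0 // subr_ge0 // ltW.
  lra.
Qed.

End RealSegments.

(** * Bounds for the real points of the bild, and their approximation *)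

Section Bild.
Variables (R : realType) (V : rightQuatHilbertType R).
Variables (T D : {linear V -> V}).
Hypotheses (Tbd : bounded_op T) (Dbd : bounded_op D).
Hypothesis TD : approx_unitarily_equiv T D.
Variables (e : nat -> V) (h s : nat -> R).
Hypotheses (e_basis : orthonormal_basis e) (s0 : forall k, 0 <= s k).
Hypothesis De : forall k, D (e k) = rscale (e k) (complexq (h k) (s k)).

Let seg k j := real_part_of
  (segment (complexq (h k) (s k)) (conjq (complexq (h j) (s j)))).

(** If the form of [T] at a unit [x] is the real number [a], the form of [D] at [S x] is within
    [del] of [a] in each component, so the penalty in [diag_form_bound] is at most
    [3 * lam * del]. *)
Lemma bild_bound (sg m : R) :
  (forall k j c, k != j -> seg k j c -> m <= sg * c) ->
  forall a, real_part_of (bild T) a -> m <= sg * a.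
Proof.
move=> hseg a /bild_real[x x1 xa].
have [||lam lam0 lamP] := @diag_form_bound R V e e_basis D h s sg m Dbd s0 De.
(* A real [d_k] is an endpoint of every segment that starts there; [k.+1] is merely an index
   different from [k]. *)
- move=> k sk0; apply: (hseg k k.+1); first by rewrite neq_ltn ltnSn.
  by apply/real_segmentP; exists 0; split; rewrite ?sk0 ?lexx ?ler01 //; ring.
- move=> k j kj.
  have := addr_ge0 (s0 k) (s0 j); rewrite le_eqVlt => /orP[/eqP/esym ss|ss].
    have [-> ->] : s k = 0 /\ s j = 0 by have := s0 k; have := s0 j; lra.
    by rewrite !mul0r addr0.
  (* The bound at the unique crossing point, multiplied by [s k + s j], is the pair condition. *)
  have := hseg k j _ kj; rewrite /seg real_segment_single // => /(_ _ erefl).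
  rewrite mulrA ler_pdivlMr //; lra.
apply/ler_addgt0Pr => eps eps0.
pose C := `|sg| + lam * 3.
have C0 : 0 <= C by rewrite addr_ge0 ?mulr_ge0.
have del0 : 0 < eps / (C + 1) by rewrite divr_gt0 // ltr_wpDl.
set del := eps / _ in del0.
have C1 : C * del <= eps.
  have : (C + 1) * del <= eps.
    by rewrite mulrC divfK // gt_eqF // ltr_wpDl.
  lra.
have [U [S [[_ adj _ US] near]]] := approx_unitary Tbd Dbd TD del0.
have Sx1 : hnorm (S x) = 1 by rewrite (adjoint_coisometry _ adj US).
have [] := near x x1.
have := lamP (S x) _ erefl.
move: (inner (D (S x)) (S x)) => q; rewrite Sx1 xa expr1n mulr1.
rewrite qreD qimiD qimjD qimkD qreN qimiN qimjN qimkN /= !subr0.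
move=> H N1 N2 N3 N4.
have H1 : sg * qre q <= sg * a + `|sg| * del.
  rewrite -lerBlDl -mulrBr; apply: le_trans (ler_norm _) _.
  by rewrite normrM ler_wpM2l.
have H2 := ler_wpM2l lam0 (lerD (lerD N2 N3) N4).
by rewrite /C in C1; lra.
Qed.

Hypothesis Tnormal : normal_op T.
Hypothesis Teig : forall k, right_eigenvalues T (complexq (h k) (s k)).

Lemma bild_near_segment k j (c eps : R) : k != j -> seg k j c -> 0 < eps ->
  exists2 a, real_part_of (bild T) a & `|a - c| <= eps.
Proof.
move=> kj /real_segmentP[t [t0 t1 cE tE]] eps0.
have [S TS comm] := Tnormal.
have [v v1 Tv] := right_eigenvalue_unit (Teig k).
have [w w1 Tw] := right_eigenvalue_unit (Teig j).
have [[hh ss]|dd] := pselect (h k = h j /\ s k = s j).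
  have -> : c = h k by rewrite cE -hh; ring.
  apply: (@bild_near_same R V T S D e (h k) (s k) k j v) => //.
  by rewrite De hh ss.
exists c; last by rewrite subrr normr0 ltW.
by rewrite cE; apply: (bild_distinct TS comm (s0 k) (s0 j) v1 Tv w1 Tw).
Qed.

(** Each [h k] is the real part of the form of [D] at [e k], hence bounded, and the points in
    question are convex combinations of two of them. *)
Lemma diag_bounded : exists M : R, forall k j c, seg k j c -> `|c| <= M.
Proof.
have [M DM] := Dbd; exists M => k j c /real_segmentP[t [t0 t1 -> _]].
have hM i : `|h i| <= M.
  have ei : inner (e i) (e i) = 1 by rewrite e_basis.1 eqxx.
  have ei1 : hnorm (e i) = 1 by apply: hnorm1_sqr; rewrite sqr_hnorm ei.
  have [|+ _ _ _] := @form_bounds R V D M (e i) (e i) M DM.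
    by rewrite ei1 !mulr1.
  by rewrite De innerZl ei mul1r.
apply: le_trans (ler_normD _ _) _; rewrite !normrM.
rewrite (ger0_norm t0) ger0_norm ?subr_ge0 //.
have : (1 - t) * `|h k| <= (1 - t) * M by rewrite ler_wpM2l ?subr_ge0.
have : t * `|h j| <= t * M by rewrite ler_wpM2l.
lra.
Qed.

End Bild.

(** * From bounds and approximation to equality of infima and suprema *)

Theorem theorem4p7 (R : realType) (V : rightQuatHilbertType R)
    (Vsep : separable_space V)
    (T : {linear V -> V}) (Tbounded : bounded_op T) (Tnormal : normal_op T)
    (D : {linear V -> V}) (Dbounded : bounded_op D)
    (TD : approx_unitarily_equiv T D)
    (e : nat -> V) (ebasis : orthonormal_basis e)
    (h s : nat -> R) (s_ge0 : forall k, 0 <= s k)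
    (De : forall k, D (e k) = rscale (e k) (complexq (h k) (s k)))
    (Teig : right_eigenvalues T =
            \bigcup_k sim_class (complexq (h k) (s k))) :
  let d k := complexq (h k) (s k) in
  let c_lo k j := min_elt (real_part_of (segment (d k) (conjq (d j)))) in
  let c_hi k j := max_elt (real_part_of (segment (d k) (conjq (d j)))) in
  inf (real_part_of (bild T)) =
    inf [set c_lo p.1 p.2 | p in [set p : nat * nat | p.1 != p.2]] /\
  sup (real_part_of (bild T)) =
    sup [set c_hi p.1 p.2 | p in [set p : nat * nat | p.1 != p.2]].
Proof.
move=> d c_lo c_hi.
pose seg k j := real_part_of (segment (d k) (conjq (d j))).
have Td k : right_eigenvalues T (complexq (h k) (s k)).
  rewrite Teig; exists k => //; exists (realq 1).
    by rewrite /Defs.normq /= expr1n expr0n /= !addr0 sqrtr1.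
  by apply: quat_eq; rewrite /= ?quatE /=; ring.
have lo k j : seg k j (c_lo k j) /\ lbound (seg k j) (c_lo k j).
  exact: (real_segment_extrema (h k) (h j) (s_ge0 k) (s_ge0 j)).1.
have hi k j : seg k j (c_hi k j) /\ ubound (seg k j) (c_hi k j).
  exact: (real_segment_extrema (h k) (h j) (s_ge0 k) (s_ge0 j)).2.
have near := bild_near_segment Tbounded Dbounded TD ebasis s_ge0 De Tnormal Td.
have bound := bild_bound Tbounded Dbounded TD ebasis s_ge0 De.
have [M segM] := diag_bounded Dbounded ebasis De.
set A := real_part_of (bild T).
set Clo := [set c_lo p.1 p.2 | p in _]; set Chi := [set c_hi p.1 p.2 | p in _].
(* Boundedness and nonemptiness of [Clo], [Chi] and [A] keep every [inf] and [sup] below from its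
   default value. *)
have Clo_lb : has_lbound Clo.
  exists (- M) => _ [[k j] _ <-].
  by have := segM _ _ _ (lo k j).1; rewrite ler_norml => /andP[].
have Chi_ub : has_ubound Chi.
  exists M => _ [[k j] _ <-].
  by have := segM _ _ _ (hi k j).1; rewrite ler_norml => /andP[].
have Clo0 : Clo !=set0 by exists (c_lo 0 1)%N, (0, 1)%N.
have Chi0 : Chi !=set0 by exists (c_hi 0 1)%N, (0, 1)%N.
have A0 : A !=set0.
  by have [a Aa _] := near 0%N 1%N _ _ isT (lo 0%N 1%N).1 ltr01; exists a.
have A_lb : lbound A (inf Clo).
  move=> a Aa; rewrite -[a]mul1r; apply: (bound) Aa => k j c kj kjc.
  rewrite mul1r; apply: le_trans ((lo k j).2 _ kjc).
  by apply: ge_inf => //; exists (k, j).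
have A_ub : ubound A (sup Chi).
  (* The bound is applied with [sg = -1] and [m = - sup Chi]. *)
  move=> a Aa; rewrite -lerN2 -[- a]mulN1r; apply: (bound) Aa => k j c kj kjc.
  rewrite mulN1r lerN2; apply: le_trans ((hi k j).2 _ kjc) _.
  by apply: ub_le_sup => //; exists (k, j).
split; apply/eqP; rewrite eq_le; apply/andP; split.
(* [c_lo k j] is itself a real point of its segment, so the bild has real points within every [eps]
   of it. *)
- apply: lb_le_inf => // _ [[k j] /= kj <-]; apply/ler_addgt0Pr => eps eps0.
  have [a Aa] := near _ _ _ _ kj (lo k j).1 eps0.
  rewrite ler_distl => /andP[_]; apply: le_trans.
  by apply: ge_inf => //; exists (inf Clo).
- exact: lb_le_inf.
- exact: ge_sup.
- apply: ge_sup => // _ [[k j] /= kj <-]; apply/ler_addgt0Pr => eps eps0.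
  have [a Aa] := near _ _ _ _ kj (hi k j).1 eps0.
  rewrite ler_distl => /andP[+ _]; rewrite lerBlDr => /le_trans; apply.
  by rewrite lerD2r; apply: ub_le_sup => //; exists (sup Chi).
Qed.
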